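(* The number of pairs $(x,y)$ of imaginary octonions such that $\frac12+x,\ \frac12+y\in\mathfrak{o}$, $N(\frac12+x)=1$, $N(\frac12+y)=1$, and $(\frac12+\bar x)(\frac12+y)=\frac12+z$ with $z$ an imaginary octonion, is $1512$.
   Context: $\mathfrak{C}_{\mathbb{Q}}=\bigoplus_{i=0}^7\mathbb{Q}e_i$ is the algebra of octonions (Cayley numbers): $e_0$ is the unit, and $e_i^2=-e_0$, $e_i(e_{i+1}e_{i+3})=(e_ie_{i+1})e_{i+3}=-e_0$ for $1\le i\le 7$ (indices modulo $7$ in $\{1,\dots,7\}$), the span of $e_0,e_i,e_{i+1},e_{i+3}$ being a quaternion algebra; $\frac12$ means $\frac12e_0$. For $x=\sum_{i=0}^7x_ie_i$ put $\bar x=2x_0e_0-x$ and $N(x)=\sum_{i=0}^7x_i^2$; $x$ is called imaginary if $x_0=0$. The lattice $\mathfrak{o}\subset\mathfrak{C}_{\mathbb{Q}}$ of integral octonions is the $\mathbb{Z}$-span of $\alpha_0=e_0$, $\alpha_1=e_1$, $\alpha_2=e_2$, $\alpha_3=-e_4$, $\alpha_4=\frac12(e_1+e_2+e_3+e_4)$, $\alpha_5=\frac12(-e_0-e_1-e_4+e_5)$, $\alpha_6=\frac12(-e_0+e_1-e_2+e_6)$, $\alpha_7=\frac12(-e_0+e_2+e_4+e_7)$. *)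

(* Defs.v *)
From mathcomp Require Import all_boot all_order all_algebra.
From mathcomp Require Import boolp classical_sets functions cardinality.

Set Implicit Arguments.
Unset Strict Implicit.
Unset Printing Implicit Defensive.

Import GRing.Theory.

Local Open Scope ring_scope.

(* [x 0 i] is the coordinate x_i of x = sum_i x_i e_i. *)
Definition octonion := 'rV[rat]_8.

(* The basis vector e_i, for i < 8. *)
Definition oct_e (i : nat) : octonion := \row_(j < 8) (j == i :> nat)%:R.

(* The index i + d, taken modulo 7 in {1, ..., 7}, for 1 <= i <= 7. *)
Definition fano_add (i d : nat) : nat := ((i.-1 + d) %% 7).+1%N.

(* The product e_i e_j.  Each relation e_i (e_{i+1} e_{i+3}) = - e_0 in a
   quaternion algebra yields the cyclic rules e_i e_{i+1} = e_{i+3},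
   e_{i+1} e_{i+3} = e_i, e_{i+3} e_i = e_{i+1} and their opposites with the
   factors exchanged; the cases below sort them by d = j - i mod 7. *)
Definition oct_table (i j : nat) : octonion :=
  if i == 0%N then oct_e j
  else if j == 0%N then oct_e i
  else match ((j + 7 - i) %% 7)%N with
       | 0 => - oct_e 0
       | 1 => oct_e (fano_add i 3)
       | 2 => oct_e (fano_add i 6)
       | 3 => - oct_e (fano_add i 1)
       | 4 => oct_e (fano_add i 5)
       | 5 => - oct_e (fano_add i 4)
       | _ => - oct_e (fano_add i 2)
       end.

Definition oct_mul (x y : octonion) : octonion :=
  \sum_(i < 8) \sum_(j < 8) (x 0 i * y 0 j) *: oct_table i j.

(* A rational number read as an octonion. *)
Definition oct_scalar (q : rat) : octonion := q *: oct_e 0.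

Definition oct_conj (x : octonion) : octonion := (2 * x 0 0) *: oct_e 0 - x.

Definition oct_norm (x : octonion) : rat := \sum_(i < 8) x 0 i ^+ 2.

Definition imaginary (x : octonion) : Prop := x 0 0 = 0.

Definition alpha : 8.-tuple octonion :=
  [tuple
    oct_e 0;
    oct_e 1;
    oct_e 2;
    - oct_e 4;
    2^-1 *: (oct_e 1 + oct_e 2 + oct_e 3 + oct_e 4);
    2^-1 *: (- oct_e 0 - oct_e 1 - oct_e 4 + oct_e 5);
    2^-1 *: (- oct_e 0 + oct_e 1 - oct_e 2 + oct_e 6);
    2^-1 *: (- oct_e 0 + oct_e 2 + oct_e 4 + oct_e 7)].

Definition integral_octonion (x : octonion) : Prop := inIntSpan alpha x.

(* The lemmas below check that [oct_mul] satisfies the defining relations of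
   the Cayley algebra. *)

Lemma oct_mul_e (i j : nat) : (i < 8)%N -> (j < 8)%N ->
  oct_mul (oct_e i) (oct_e j) = oct_table i j.
Proof.
move=> lti ltj; rewrite /oct_mul (bigD1 (Ordinal lti)) //=.
rewrite [X in _ + X]big1 => [|k neq_ki]; last first.
  apply: big1 => l _; rewrite !mxE (_ : (k == i :> nat) = false).
    by rewrite mul0r scale0r.
  by apply: contraNF neq_ki => /eqP eq_ki; apply/eqP/val_inj.
rewrite addr0 (bigD1 (Ordinal ltj)) //= big1 => [|l neq_lj]; last first.
  rewrite !mxE (_ : (l == j :> nat) = false); first by rewrite mulr0 scale0r.
  by apply: contraNF neq_lj => /eqP eq_lj; apply/eqP/val_inj.
by rewrite !mxE !eqxx mulr1 scale1r addr0.
Qed.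

Lemma oct_mulDl (x y z : octonion) :
  oct_mul (x + y) z = oct_mul x z + oct_mul y z.
Proof.
rewrite /oct_mul -big_split; apply: eq_bigr => i _ /=.
rewrite -big_split; apply: eq_bigr => j _ /=.
by rewrite !mxE mulrDl scalerDl.
Qed.

Lemma oct_mulDr (x y z : octonion) :
  oct_mul x (y + z) = oct_mul x y + oct_mul x z.
Proof.
rewrite /oct_mul -big_split; apply: eq_bigr => i _ /=.
rewrite -big_split; apply: eq_bigr => j _ /=.
by rewrite !mxE mulrDr scalerDl.
Qed.

Lemma oct_mulZl (a : rat) (x y : octonion) :
  oct_mul (a *: x) y = a *: oct_mul x y.
Proof.
rewrite /oct_mul scaler_sumr; apply: eq_bigr => i _ /=.
rewrite scaler_sumr; apply: eq_bigr => j _ /=.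
by rewrite !mxE scalerA mulrA.
Qed.

Lemma oct_mulZr (a : rat) (x y : octonion) :
  oct_mul x (a *: y) = a *: oct_mul x y.
Proof.
rewrite /oct_mul scaler_sumr; apply: eq_bigr => i _ /=.
rewrite scaler_sumr; apply: eq_bigr => j _ /=.
by rewrite !mxE scalerA mulrCA.
Qed.

Lemma oct_mulNl (x y : octonion) : oct_mul (- x) y = - oct_mul x y.
Proof. by rewrite -scaleN1r oct_mulZl scaleN1r. Qed.

Lemma oct_mulNr (x y : octonion) : oct_mul x (- y) = - oct_mul x y.
Proof. by rewrite -scaleN1r oct_mulZr scaleN1r. Qed.

Lemma oct_basisE (x : octonion) : x = \sum_(i < 8) x 0 i *: oct_e i.
Proof.
apply/rowP => j; rewrite summxE (bigD1 j) //= big1 => [|i neq_ij].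
  by rewrite !mxE eqxx mulr1 addr0.
rewrite !mxE (_ : (j == i :> nat) = false) ?mulr0 //.
by rewrite eq_sym; apply: negbTE.
Qed.

Lemma oct_mul1l (x : octonion) : oct_mul (oct_e 0) x = x.
Proof.
rewrite /oct_mul (bigD1 ord0) //= [X in _ + X]big1 => [|i neq_i0]; last first.
  apply: big1 => j _; rewrite !mxE (_ : (i == 0 :> nat) = false).
    by rewrite mul0r scale0r.
  exact: negbTE.
rewrite addr0 [RHS]oct_basisE; apply: eq_bigr => j _.
by rewrite !mxE /= mul1r.
Qed.

Lemma oct_mul1r (x : octonion) : oct_mul x (oct_e 0) = x.
Proof.
rewrite /oct_mul [RHS]oct_basisE; apply: eq_bigr => i _.
rewrite (bigD1 ord0) //= big1 => [|j neq_j0]; last first.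
  rewrite !mxE (_ : (j == 0 :> nat) = false) ?mulr0 ?scale0r //.
  exact: negbTE.
rewrite !mxE /= mulr1 addr0 /oct_table.
by case: eqP => [->|].
Qed.

Lemma oct_relations (i : nat) : (0 < i < 8)%N ->
  let e0 := oct_e 0 in
  let e1 := oct_e i in
  let e2 := oct_e (fano_add i 1) in
  let e4 := oct_e (fano_add i 3) in
  [/\ oct_mul e1 e1 = - e0,
      oct_mul e1 (oct_mul e2 e4) = - e0,
      oct_mul (oct_mul e1 e2) e4 = - e0 &
      oct_mul e1 e2 = e4 /\ oct_mul e2 e1 = - e4].
Proof.
case: i => // -[|[|[|[|[|[|[|//]]]]]]] _ /=;
  by rewrite /fano_add /= !(oct_mul_e, oct_mulNl, oct_mulNr).
Qed.

Lemma oct_quaternion_assoc (i : nat) : (0 < i < 8)%N ->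
  {in [:: 0; i; fano_add i 1; fano_add i 3]%N & &, forall a b c : nat,
    oct_mul (oct_e a) (oct_mul (oct_e b) (oct_e c)) =
    oct_mul (oct_mul (oct_e a) (oct_e b)) (oct_e c)}.
Proof.
case: i => // -[|[|[|[|[|[|[|//]]]]]]] _ a b c; rewrite /fano_add /= !inE;
  do 3![case/or4P => /eqP->];
  by rewrite !(oct_mul_e, oct_mulNl, oct_mulNr, oct_mul1l, oct_mul1r, opprK).
Qed.

(* Main.v *)
Require Import Defs.
From mathcomp Require Import zify ring lra.
From mathcomp Require Import all_boot all_order all_algebra.
From mathcomp Require Import boolp classical_sets functions cardinality.

Set Implicit Arguments.
Unset Strict Implicit.
Unset Printing Implicit Defensive.

Import Order.TTheory GRing.Theory Num.Theory.

Local Open Scope ring_scope.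
Local Open Scope classical_set_scope.
Local Open Scope card_scope.

(** Write a = 1/2 + x and b = 1/2 + y.  Since x is imaginary, 1/2 + conj x is
    the conjugate of a, and the real part of (conj a) b is the Euclidean inner
    product of a and b ([re_conj_mul]).  So the pairs to be counted are the pairs
    of unit vectors a, b of the lattice whose inner products with the unit e_0
    and with each other are all 1/2.

    The lattice is the E8 lattice, in its construction from a binary code:
    2a runs over the integer vectors whose reduction modulo 2 lies in the
    extended Hamming code of length 8 ([integral_octonionP]).  For a unit vector
    with real part 1/2, the vector v = 2a satisfies v_0 = 1 and |v|^2 = 4, hence
    has exactly three other nonzero entries, all equal to 1 or -1, and these lie
    on one of the seven codewords of weight 4 through the coordinate 0.  The
    seven supports are the lines of a Fano plane, so there are 7 * 8 = 56 such
    vectors.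

    Fix one of them, v.  The inner product of 2a and 2b must be 2, of which the
    coordinate 0 contributes 1.  On the line of v, three of the eight sign
    patterns give the remaining 1 (exactly one sign differs).  Each of the six
    other lines meets that of v in one point, where the signs must agree, which
    leaves four patterns.  Hence 3 + 6 * 4 = 27 partners, and 56 * 27 = 1512.

    Once the problem is reduced to integer vectors ([unit_rootsP]), this last
    count is an enumeration of a finite list, carried out by evaluation. *)

(** Integer vectors are sequences rather than matrices, so that the enumeration
    below can be evaluated. *)
Definition oct_half (v : seq int) : octonion := \row_(j < 8) ((v`_j)%:~R / 2).

Lemma oct_half_inj v w :
  size v = 8%N -> size w = 8%N -> oct_half v = oct_half w -> v = w.
Proof.
move=> sv sw /rowP eq_vw.
apply: (@eq_from_nth _ 0) => [|i]; rewrite sv // => lt_i8.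
have:= eq_vw (Ordinal lt_i8); rewrite !mxE /= => /(mulIf _) eq_i.
by apply/eqP; rewrite -(eqr_int rat) eq_i ?invr_eq0.
Qed.

Definition dot (v w : seq int) : int :=
  foldr (fun p s => p.1 * p.2 + s) 0 (zip v w).

Lemma dot_oct_half v w : size v = 8 -> size w = 8 ->
  \sum_(i < 8) oct_half v 0 i * oct_half w 0 i = (dot v w)%:~R / 4.
Proof.
case: v => [|v0 [|v1 [|v2 [|v3 [|v4 [|v5 [|v6 [|v7 [|//]]]]]]]]] // _.
case: w => [|w0 [|w1 [|w2 [|w3 [|w4 [|w5 [|w6 [|w7 [|//]]]]]]]]] // _.
rewrite !big_ord_recl big_ord0 !mxE /= /dot /=.
rewrite !(rmorphD, rmorphM, rmorph0) /=.
by field.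
Qed.

(** Four independent parity checks of the extended Hamming code of length 8. *)
Definition parity_checks (v : seq int) : bool :=
  all (fun x => (2 %| x)%Z)
    [:: v`_0 + v`_5 + v`_6 + v`_7; v`_1 + v`_3 + v`_5 + v`_6;
        v`_2 + v`_3 + v`_6 + v`_7; v`_3 + v`_4 + v`_5 + v`_7].

(** The doubled coordinates of a combination of the [alpha]s.  The coordinates
    3, 5, 6 and 7 can be chosen freely, and they fix the other four modulo 2:
    this is what the parity checks express. *)
Lemma span_alphaE (n : nat -> int) :
  \sum_(i < 8) alpha`_i *~ n i =
  oct_half [:: 2 * n 0%N - n 5 - n 6 - n 7; 2 * n 1%N + n 4 - n 5 + n 6;
               2 * n 2 + n 4 - n 6 + n 7; n 4; n 4 - 2 * n 3 - n 5 + n 7;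
               n 5; n 6; n 7].
Proof.
apply/rowP => j; rewrite summxE !big_ord_recl big_ord0 /= -!scaler_int.
case: j => [[|[|[|[|[|[|[|[|//]]]]]]]] j_lt];
  rewrite !mxE /= /bump /= ?(rmorphD, rmorphB, rmorphN, rmorphM) /=;
  lra.
Qed.

Lemma integral_octonionP a :
  integral_octonion a <->
  exists v, [/\ size v = 8%N, parity_checks v & a = oct_half v].
Proof.
split=> [[c ->] | [v [sv cv ->]]].
  pose n k := c (inord k).
  have -> : \sum_(i < 8) alpha`_i *~ c i = \sum_(i < 8) alpha`_i *~ n i.
    by apply: eq_bigr => i _; rewrite /n inord_val.
  rewrite span_alphaE; eexists; split; last by []; first by [].
  by rewrite /parity_checks /=; lia.
move: sv cv.
case: v => [|v0 [|v1 [|v2 [|v3 [|v4 [|v5 [|v6 [|v7 [|//]]]]]]]]] // _.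
rewrite /parity_checks /= => cv.
(* The triangular system of [span_alphaE], solved for the coefficients. *)
pose n := [:: ((v0 + v5 + v6 + v7) %/ 2)%Z; ((v1 - v3 + v5 - v6) %/ 2)%Z;
              ((v2 - v3 + v6 - v7) %/ 2)%Z; ((v3 - v4 - v5 + v7) %/ 2)%Z;
              v3; v5; v6; v7].
exists [ffun i : 'I_8 => n`_i].
under eq_bigr do rewrite ffunE.
rewrite (span_alphaE (fun k => n`_k)) /=.
by congr (oct_half [:: _; _; _; _; _; _; _; _]); lia.
Qed.

Lemma re_oct_table (i j : 'I_8) :
  oct_table i j 0 0 = if i == j then (if i == 0 then 1 else -1) else 0.
Proof.
by case: i j => [[|[|[|[|[|[|[|[|//]]]]]]]] i_lt]
                [[|[|[|[|[|[|[|[|//]]]]]]]] j_lt] //=;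
   rewrite /oct_table /= !mxE.
Qed.

(** The real part of a product only sees the squares of the basis vectors; the
    imaginary ones square to -1, a sign that the conjugation cancels. *)
Lemma re_conj_mul (a b : octonion) :
  oct_mul (oct_conj a) b 0 0 = \sum_(i < 8) a 0 i * b 0 i.
Proof.
rewrite /oct_mul summxE; apply: eq_bigr => i _.
rewrite summxE (bigD1 i) //= big1 => [|j ne_ji]; last first.
  by rewrite mxE re_oct_table eq_sym (negbTE ne_ji) mulr0.
rewrite addr0 mxE re_oct_table eqxx.
have [-> | ne_i0] := eqVneq i 0; rewrite !mxE /=; first by ring.
by rewrite -val_eqE in ne_i0; rewrite (negbTE ne_i0) mulr0 sub0r mulNr mulrN1 opprK.
Qed.

Fixpoint words (n : nat) : seq (seq int) :=
  if n is n'.+1 then [seq x :: s | x <- [:: -1; 0; 1], s <- words n']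
  else [:: [::]].

(* The list must not be expanded by simplification. *)
Arguments words : simpl never.

Lemma mem_words n s :
  (s \in words n) = (size s == n) && all (mem [:: -1; 0; 1]) s.
Proof.
elim: n s => [|n IHn] [|x s]; rewrite ?inE //.
  by apply/negP => /allpairsP[[y t] []].
rewrite [all _ _]/= [size _]/= eqSS andbCA -IHn.
apply/allpairsP/andP => [[[y t] [/= Hy Ht [-> ->]]] //| [Hx Hs]].
by exists (x, s).
Qed.

(** An entry of absolute value at least 2 alone contributes 4. *)
Lemma short_entries s : dot s s < 4 -> all (mem [:: -1; 0; 1]) s.
Proof.
have dot_ge0 t : 0 <= dot t t.
  by elim: t => //= x t IHt; rewrite /dot /= addr_ge0 // -expr2 sqr_ge0.
elim: s => //= x s IHs; rewrite {1}/dot /= -/(dot s s) => lt4.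
have:= dot_ge0 s; rewrite IHs ?andbT => [|]; last by nia.
by rewrite !inE => ds; nia.
Qed.

(** The doubles 2a of the integral octonions a of norm 1 and real part 1/2. *)
Definition unit_roots : seq (seq int) :=
  [seq v <- [seq 1 :: s | s <- words 7] | (dot v v == 4) && parity_checks v].

Lemma mem_unit_roots v :
  (v \in unit_roots) =
  [&& size v == 8%N, v`_0 == 1, dot v v == 4 & parity_checks v].
Proof.
rewrite mem_filter andbC; apply/andP/and4P => [[/mapP[s]] | ].
  by rewrite mem_words => /andP[/eqP ss _] -> /andP[-> ->]; rewrite /= ss.
case: v => [[]// | x s [ss /eqP x1 dv ->]].
rewrite [nth _ _ _]/= in x1; subst x; rewrite dv; split=> //.
apply/mapP; exists s => //; rewrite mem_words -(eqSS _ 7) ss short_entries //.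
by move: dv; rewrite /dot /=; lia.
Qed.

(** The inner product 1/2 of two octonions becomes 2 on their doubles. *)
Definition root_pairs : seq (seq int * seq int) :=
  [seq p <- [seq (v, w) | v <- unit_roots, w <- unit_roots] |
     dot p.1 p.2 == 2].

Lemma size_root_pairs : size root_pairs = 1512%N.
Proof. by vm_compute. Qed.

Lemma uniq_root_pairs : uniq root_pairs.
Proof.
have U : uniq unit_roots by vm_compute.
by apply: filter_uniq; apply: (allpairs_uniq U U) => -[? ?] [? ?].
Qed.

Lemma card_set_seq (T : eqType) (s : seq T) : uniq s -> [set` s] #= `I_(size s).
Proof.
case: s => [|x0 s']; first by rewrite II0 set_nil.
set s := x0 :: s' => us.
have -> : [set` s] = nth x0 s @` `I_(size s).
  apply/seteqP; split=> [x /= xs | _ [i lti <-]]; last exact: mem_nth.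
  by exists (index x s); [rewrite -index_mem in xs | rewrite nth_index].
apply: inj_card_eq => i j; rewrite !inE => lti ltj /eqP.
by rewrite nth_uniq // => /eqP.
Qed.

(* Deciding membership by unfolding these lists is far too costly for the
   trivial-goal tactics; below, [mem_unit_roots] characterizes it. *)
Local Opaque unit_roots root_pairs.

Lemma unit_rootsP a :
  [/\ integral_octonion a, oct_norm a = 1 & a 0 0 = 2^-1] <->
  exists2 v, v \in unit_roots & a = oct_half v.
Proof.
have normE v : size v = 8%N -> oct_norm (oct_half v) = (dot v v)%:~R / 4.
  by move=> sv; rewrite -dot_oct_half //; apply: eq_bigr => i _; rewrite expr2.
have re_halfE v : oct_half v 0 0 = (v`_0)%:~R / 2 by rewrite mxE.
split=> [[/integral_octonionP[v [sv cv ->]]] | [v]].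
  rewrite normE // re_halfE => norm1 re1; exists v => //.
  rewrite mem_unit_roots sv cv andbT -!(eqr_int rat) /=.
  by apply/andP; split; apply/eqP; lra.
rewrite mem_unit_roots => /and4P[/eqP sv /eqP v0 /eqP nv cv] ->.
split; first by apply/integral_octonionP; exists v.
  by rewrite normE // nv; field.
by rewrite re_halfE v0; field.
Qed.

(** Any octonion with real part 1/2 is 1/2 + z with z imaginary, so that the
    condition on the product only concerns its real part. *)
Lemma mul_conj_re_half a b :
  (exists z, imaginary z /\ oct_mul (oct_conj a) b = oct_scalar 2^-1 + z) <->
  \sum_(i < 8) a 0 i * b 0 i = 2^-1.
Proof.
have h0 : oct_scalar 2^-1 0 0 = 2^-1 by rewrite !mxE mulr1.
rewrite -re_conj_mul /imaginary; split=> [[z [z0 ->]] | re].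
  by rewrite mxE h0 z0 addr0.
exists (oct_mul (oct_conj a) b - oct_scalar 2^-1).
by split; [rewrite mxE re mxE h0 subrr | rewrite addrC subrK].
Qed.

Theorem proposition3p7 :
  [set p : octonion * octonion |
    let (x, y) := p in
    let h := oct_scalar 2^-1 in
    (imaginary x /\ imaginary y) /\
    [/\ integral_octonion (h + x),
        integral_octonion (h + y),
        oct_norm (h + x) = 1,
        oct_norm (h + y) = 1 &
        exists z : octonion,
          imaginary z /\ oct_mul (h + oct_conj x) (h + y) = h + z]]
  #= `I_1512.
Proof.
set h := oct_scalar 2^-1.
have h0 : h 0 0 = 2^-1 by rewrite !mxE mulr1.
have imE x : imaginary x <-> (h + x) 0 0 = 2^-1.
  by rewrite mxE h0 /imaginary; split=> [-> | ?]; [rewrite addr0 | lra].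
have conjE x : imaginary x -> h + oct_conj x = oct_conj (h + x).
  move=> x0; rewrite /oct_conj mxE x0 addr0 mulr0 scale0r sub0r h0 divff //.
  rewrite opprD addrA; congr (_ - x); rewrite /h /oct_scalar -scalerBl.
  by congr (_ *: _); field.
pose f (p : seq int * seq int) := (oct_half p.1 - h, oct_half p.2 - h).
(* The pairs counted are the translates of the octonions with doubles in
   [root_pairs], and [f] is injective on that list. *)
rewrite [X in X #= _](_ : _ = f @` [set` root_pairs]); last first.
  apply/seteqP; split=> [[x y] /= [[imx imy]] | _ [[v w] /= + <-]].
    case=> ox oy nx ny; rewrite conjE // => /mul_conj_re_half.
    have [v Rv Ev] := (unit_rootsP _).1 (And3 ox nx ((imE x).1 imx)).
    have [w Rw Ew] := (unit_rootsP _).1 (And3 oy ny ((imE y).1 imy)).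
    have [sv sw] : size v = 8%N /\ size w = 8%N.
      by move: Rv Rw; rewrite !mem_unit_roots => /andP[/eqP-> _] /andP[/eqP->].
    rewrite Ev Ew dot_oct_half // => dot_vw; exists (v, w).
      rewrite /= mem_filter /= allpairs_f // andbT -(eqr_int rat).
      by apply/eqP; lra.
    by rewrite /f /= -Ev -Ew ![h + _]addrC !addrK.
  rewrite mem_filter => /andP[/eqP /= dot_vw /allpairsP[[v' w'] /=]].
  case=> Rv Rw [Ev Ew]; subst v' w'.
  have [ov nv rv] := (unit_rootsP (oct_half v)).2 (ex_intro2 _ _ v Rv erefl).
  have [ow nw rw] := (unit_rootsP (oct_half w)).2 (ex_intro2 _ _ w Rw erefl).
  have [sv sw] : size v = 8%N /\ size w = 8%N.
    by move: Rv Rw; rewrite !mem_unit_roots => /andP[/eqP-> _] /andP[/eqP->].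
  have hK a : h + (a - h) = a by rewrite addrC subrK.
  have [imv imw] : imaginary (oct_half v - h) /\ imaginary (oct_half w - h).
    by split; apply/imE; rewrite hK.
  rewrite (conjE _ imv) !hK; do !split=> //.
  by rewrite mul_conj_re_half dot_oct_half // dot_vw; field.
have size_pair p : p \in root_pairs -> size p.1 = 8%N /\ size p.2 = 8%N.
  rewrite mem_filter => /andP[_ /allpairsP[[v w] [/= + + ->]]].
  by rewrite !mem_unit_roots => /andP[/eqP-> _] /andP[/eqP-> _].
have f_inj : {in [set` root_pairs] &, injective f}.
  move=> [v w] [v' w']; rewrite !inE.
  move=> /size_pair[/= sv sw] /size_pair[/= sv' sw'].
  by case=> /addIr/(oct_half_inj sv sv')-> /addIr/(oct_half_inj sw sw')->.
rewrite (card_eql (inj_card_eq f_inj)) -size_root_pairs.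
exact/card_set_seq/uniq_root_pairs.
Qed.
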